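(* For every $0<\varepsilon<1$ there is a deterministic, stateless, $(1-\varepsilon)$-approximate $\mathrm{CentLocal}[\varphi]$-algorithm for maximum matching, where $\varphi=(\log^* n)^{\lceil 1/\varepsilon\rceil +1}\cdot 2^{\Delta^{O(1/\varepsilon)}}$. That is, on a query edge $e$ it answers whether $e\in M$, where $M$ is a fixed matching of $G$ with $|M|\ge(1-\varepsilon)|M^*|$ for a maximum cardinality matching $M^*$.
   Context: Graphs are undirected and labeled: $n$ vertices with distinct IDs in $\{1,\dots,n\}$, each vertex $v$ has ports $1,\dots,\deg(v)$ pointing to its neighbors in an arbitrary fixed way; $\Delta$ is the maximum degree. In the CentLocal model an algorithm knows $n,\Delta$ and accesses the graph only via probes $(v,i)$ returning the $i$-th neighbor of $v$ (and the port number of $v$ at that neighbor), or null. It answers an online sequence of queries and must be consistent with a single fixed solution for all query sequences. $\mathrm{CentLocal}[q]$ means consistent with at most $q$ probes per query; stateless means no information is stored between queries. *)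

(* Defs.v *)
From mathcomp Require Import all_boot all_order all_algebra archimedean.
From mathcomp Require Import reals exp.

Set Implicit Arguments.
Unset Strict Implicit.
Unset Printing Implicit Defensive.

Import Order.TTheory GRing.Theory Num.Theory.
Local Open Scope ring_scope.

(* A vertex is identified with its ID; IDs are shifted to {0, ..., n-1}.
   Port i (1 <= i <= deg v) of v leads to the (i-1)-th entry of [nbrs v], so
   the order of the list is the arbitrary port assignment. *)
Record labeled_graph (n : nat) := LabeledGraph {
  nbrs : 'I_n -> seq 'I_n;
  nbrs_uniq : forall v, uniq (nbrs v);
  nbrs_irrefl : forall v, v \notin nbrs v;
  nbrs_sym : forall u v, (u \in nbrs v) = (v \in nbrs u)
}.

Section Graph.
Variables (n : nat) (G : labeled_graph n).

Definition deg (v : 'I_n) : nat := size (nbrs G v).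

Definition max_degree : nat := (\max_(v < n) deg v)%N.

Definition edges : {set {set 'I_n}} :=
  [set e | [exists u, exists v, (v \in nbrs G u) && (e == [set u; v])]].

Definition matching (M : {set {set 'I_n}}) : Prop :=
  M \subset edges /\ trivIset M.

Definition maximum_matching (M : {set {set 'I_n}}) : Prop :=
  matching M /\ forall M', matching M' -> (#|M'| <= #|M|)%N.

(* The second component of a reply is the port of v at the neighbor found. *)
Definition probe (v : 'I_n) (i : nat) : option ('I_n * nat) :=
  if i is j.+1 then
    omap (fun u => (u, (index v (nbrs G u)).+1)) (onth (nbrs G v) j)
  else None.

End Graph.

Definition approx_max_matching (R : realType) (eps : R) (n : nat)
    (G : labeled_graph n) (M : {set {set 'I_n}}) : Prop :=
  matching G M /\
  forall Mstar, maximum_matching G Mstar ->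
    (1 - eps) * #|Mstar|%:R <= #|M|%:R.

(* A deterministic adaptive probing strategy ending with a result in A. *)
Inductive probing (n : nat) (A : Type) : Type :=
| Return of A
| Probe of 'I_n & nat & (option ('I_n * nat) -> probing n A).

Arguments Return {n A} _.
Arguments Probe {n A} _ _ _.

Fixpoint exec (n : nat) (A : Type) (G : labeled_graph n) (t : probing n A) : A :=
  match t with
  | Return a => a
  | Probe v i k => exec G (k (probe G v i))
  end.

Fixpoint probes (n : nat) (A : Type) (G : labeled_graph n) (t : probing n A) : nat :=
  match t with
  | Return _ => 0
  | Probe v i k => (probes G (k (probe G v i))).+1
  end.

(* A deterministic algorithm answering edge queries.  The second index D is the
   maximum degree of the input graph, which the algorithm knows along with n.
   The state is what is stored from one query to the next. *)
Record edge_algorithm := EdgeAlgorithm {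
  state : nat -> nat -> Type;
  init : forall n D, state n D;
  answer : forall n D, state n D -> {set 'I_n} -> probing n (bool * state n D)
}.

Definition stateless (A : edge_algorithm) : Prop :=
  forall n D (s t : state A n D), s = t.

(* The answer to each query of the sequence with the number of probes made. *)
Fixpoint run (A : edge_algorithm) (n : nat) (G : labeled_graph n) (D : nat)
    (s : state A n D) (qs : seq {set 'I_n}) : seq (bool * nat) :=
  if qs is e :: qs' then
    let t := answer s e in
    ((exec G t).1, probes G t) :: run G (exec G t).2 qs'
  else [::].

(* CentLocal[q] for the problem of finding an edge set satisfying [sol]. *)
Definition CentLocal (R : realType)
    (sol : forall n, labeled_graph n -> {set {set 'I_n}} -> Prop)
    (q : nat -> nat -> R) (A : edge_algorithm) : Prop :=
  forall n (G : labeled_graph n), exists M : {set {set 'I_n}},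
    sol n G M /\
    forall qs : seq {set 'I_n}, {subset qs <= edges G} ->
      let r := run G (init A n (max_degree G)) qs in
      unzip1 r = [seq e \in M | e <- qs] /\
      {in unzip2 r, forall p : nat, p%:R <= q n (max_degree G)}.

Section LogStar.
Variable R : realType.

Definition log2 (x : R) : R := ln x / ln 2.

Lemma log2_iter_le1 (n : nat) : exists k, iter k log2 n%:R <= 1.
Proof.
suff H (m : nat) : forall x : R, x <= m%:R -> exists k, iter k log2 x <= 1.
  exact: (H n).
elim: m => [|m IHm] x lexm.
  by exists 0; rewrite /= (le_trans lexm) ?ler01.
have [x_le1|x_gt1] := leP x 1; first by exists 0.
have x_gt0 : 0 < x by exact: lt_trans x_gt1.
have [|k lek] := IHm (log2 x); last by exists k.+1; rewrite iterSr.
have ln2_gt0 : 0 < ln (2 : R) by rewrite ln_gt0 // ltr1n.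
rewrite /log2 ler_pdivrMr // mulr_natl -lnXn // ler_ln ?posrE ?exprn_gt0 //.
by rewrite (le_trans lexm) // -natrX ler_nat ltn_expl.
Qed.

Definition logstar (n : nat) : nat := ex_minn (log2_iter_le1 n).

(* (log* n)^(ceil(1/eps) + 1) * 2^(D^(C/eps)), with C the constant hidden in the
   O(1/eps) of the exponent. *)
Definition probe_bound (C eps : R) (n D : nat) : R :=
  (logstar n)%:R ^ (Num.ceil (1 / eps) + 1) * 2 `^ (D%:R `^ (C / eps)).

End LogStar.

(* Main.v *)
Require Import Defs.
From mathcomp Require Import all_boot all_order all_algebra.
From mathcomp Require Import finfield boolp reals exp.
From mathcomp Require Import zify lra.

(** The algorithm first colours a power of G, of exponent O(1/eps), with
    Delta^O(1/eps) colours: Cole-Vishkin along log* n steps of each of the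
    functional graphs covering that power, followed by one step of Linial's
    colour reduction.  It then improves the empty matching by local search.  At
    each step all vertices of one colour act simultaneously, each of them
    augmenting the current matching inside a small ball around it if it can;
    the balls are disjoint since the colours are proper for the power graph.

    No Hopcroft-Karp phases are needed.  Let m be the current matching and s
    an optimal one.  Following edges of s and m alternately from the m-free
    vertices shows that, as long as m is not (1 - eps)-approximate, a number of
    m-free vertices proportional to eps |s| start augmenting paths of length
    O(1/eps).  A sweep over all colours matches a free vertex near each of them,
    hence at least a Delta^-O(1/eps) fraction as many free vertices, and
    Delta^O(1/eps) sweeps suffice.  The resulting matching at a vertex is thus
    determined by the coloured ball of radius Delta^O(1/eps) around it, which has
    2^(Delta^O(1/eps)) vertices, and each colour costs O(log* n) Delta^O(1/eps)
    probes. *)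

Set Implicit Arguments.
Unset Strict Implicit.
Unset Printing Implicit Defensive.

Lemma deg_le_max (n : nat) (G : labeled_graph n) v : deg G v <= max_degree G.
Proof. exact: (leq_bigmax (F := deg G)). Qed.

(** * Balls *)

Section Ball.
Variable n : nat.
Implicit Types (G : labeled_graph n) (v w x y z : 'I_n).

(* A list with repetitions: only its members and a bound on its size matter. *)
Fixpoint ball G (r : nat) v : seq 'I_n :=
  if r is r'.+1 then flatten [seq x :: nbrs G x | x <- ball G r' v] else [:: v].

Lemma ballSP G r v y :
  reflect (exists2 x, x \in ball G r v & y = x \/ y \in nbrs G x)
          (y \in ball G r.+1 v).
Proof.
apply: (iffP flatten_mapP) => -[x xb].
  by rewrite inE => /orP[/eqP|]; exists x; auto.
by case=> [->|yx]; exists x; rewrite // inE ?eqxx ?yx ?orbT.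
Qed.

Lemma ball_trans G r r' x y z :
  y \in ball G r x -> z \in ball G r' y -> z \in ball G (r + r') x.
Proof.
move=> xy; elim: r' z => [|r' IHr] z; first by rewrite addn0 inE => /eqP->.
by rewrite addnS => /ballSP[w /IHr wx wz]; apply/ballSP; exists w.
Qed.

Lemma ball_center G r v : v \in ball G r v.
Proof.
by elim: r => [|r IHr]; rewrite ?mem_head //; apply/ballSP; exists v; auto.
Qed.

Lemma ball_mono G r r' v : r <= r' -> {subset ball G r v <= ball G r' v}.
Proof.
move=> le_r x xv; rewrite -(subnKC le_r).
exact: ball_trans xv (ball_center _ _ _).
Qed.

Lemma ball_sym G r v w : w \in ball G r v -> v \in ball G r w.
Proof.
elim: r w => [|r IHr] w; first by rewrite !inE eq_sym.
case/ballSP=> x /IHr vx wx; apply: (@ball_trans _ 1 r _ x) => //.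
by apply/ballSP; exists w; rewrite ?mem_head // nbrs_sym; case: wx; auto.
Qed.

Lemma ball_local G G' r v :
  {in ball G r v, nbrs G =1 nbrs G'} -> ball G r v = ball G' r v.
Proof.
elim: r => //= r IHr eqG; congr flatten.
have {}eqG : {in ball G r v, nbrs G =1 nbrs G'}.
  by move=> x xv; apply: eqG; apply: (ball_mono (leqnSn r)).
by rewrite -IHr //; apply/eq_in_map => x /eqG->.
Qed.

Lemma size_ball G D r v : max_degree G <= D -> size (ball G r v) <= D.+1 ^ r.
Proof.
move=> GD; elim: r => //= r IHr; rewrite expnSr.
apply: leq_trans (leq_mul IHr (leqnn _)); elim: ball => //= x s IHs.
by rewrite size_cat mulSn /= addSn ltnS leq_add // (leq_trans (deg_le_max G x)).
Qed.

End Ball.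

(** * Functions of the graph that can be evaluated with few probes *)

Fixpoint bind (n : nat) (A B : Type) (t : probing n A) (k : A -> probing n B) :
    probing n B :=
  match t with
  | Return a => k a
  | Probe v i c => Probe v i (fun reply => bind (c reply) k)
  end.

Lemma exec_bind (n : nat) (A B : Type) (G : labeled_graph n) (t : probing n A)
    (k : A -> probing n B) : exec G (bind t k) = exec G (k (exec G t)).
Proof. by elim: t => //= v i c IH; rewrite IH. Qed.

Lemma probes_bind (n : nat) (A B : Type) (G : labeled_graph n)
    (t : probing n A) (k : A -> probing n B) :
  probes G (bind t k) = probes G t + probes G (k (exec G t)).
Proof. by elim: t => //= v i c IH; rewrite IH addSn. Qed.

Definition probe_computable (n D q : nat) (A : Type) (f : labeled_graph n -> A) :=
  exists t : probing n A, forall G, max_degree G <= D ->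
    exec G t = f G /\ probes G t <= q.

Definition edgeless_graph (n : nat) : labeled_graph n :=
  @LabeledGraph n (fun=> [::]) (fun=> isT) (fun=> isT) (fun _ _ => erefl).

Section ProbeComputable.
Variables n D : nat.
Implicit Types (G : labeled_graph n) (A B : Type).

Lemma probe_computable_cst A (a : A) :
  probe_computable D 0 (fun _ : labeled_graph n => a).
Proof. by exists (Return a). Qed.

Lemma probe_computable_bind (q q1 : nat) A B (q2 : A -> nat)
    (f : labeled_graph n -> A) (g : A -> labeled_graph n -> B) :
  probe_computable D q1 f -> (forall a, probe_computable D (q2 a) (g a)) ->
  (forall G, max_degree G <= D -> q1 + q2 (f G) <= q) ->
  probe_computable D q (fun G => g (f G) G).
Proof.
move=> [t tP] /choice[k kP] le_q; exists (bind t k) => G GD.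
have [tE tq] := tP G GD; have [kE kq] := kP (f G) G GD.
rewrite exec_bind probes_bind tE kE; split=> //.
by apply: leq_trans (le_q G GD); apply: leq_add.
Qed.

Lemma probe_computable_le (q q' : nat) A (f : labeled_graph n -> A) :
  q <= q' -> probe_computable D q f -> probe_computable D q' f.
Proof.
move=> le_q [t tP]; exists t => G GD; have [tE tq] := tP G GD.
by split=> //; apply: leq_trans le_q.
Qed.

Lemma probe_computable_comp (q : nat) A B (f : labeled_graph n -> A)
    (h : A -> B) :
  probe_computable D q f -> probe_computable D q (h \o f).
Proof.
move=> f_comp.
apply: (probe_computable_bind (q2 := fun=> 0) (g := fun a _ => h a) f_comp).
  by move=> a; apply: probe_computable_cst.
by move=> G _; rewrite addn0.
Qed.

Lemma probe_computable_pair (q1 q2 : nat) A B (f : labeled_graph n -> A)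
    (g : labeled_graph n -> B) :
  probe_computable D q1 f -> probe_computable D q2 g ->
  probe_computable D (q1 + q2) (fun G => (f G, g G)).
Proof.
move=> f_comp g_comp.
apply: (probe_computable_bind (q2 := fun=> q2) (g := fun a G => (a, g G)) f_comp)
  => // a.
exact: (probe_computable_comp (pair a)).
Qed.

Lemma probe_computable_map (q : nat) (T : Type) A (f : T -> labeled_graph n -> A)
    (s : seq T) :
  (forall x, probe_computable D q (f x)) ->
  probe_computable D (size s * q) (fun G => [seq f x G | x <- s]).
Proof.
move=> f_comp; elim: s => [|x s IHs]; first exact: probe_computable_cst.
exact: probe_computable_comp (fun p => p.1 :: p.2)
  (probe_computable_pair (f_comp x) IHs).
Qed.

Lemma probe_computable_traject (q t : nat) (T : Type)
    (f : labeled_graph n -> T -> T) (x : T) :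
  (forall y, probe_computable D q (f^~ y)) ->
  probe_computable D (t * q) (fun G => traject (f G) x t).
Proof.
move=> f_comp; elim: t x => [|t IHt] x; first exact: probe_computable_cst.
apply: (probe_computable_comp (cons x)).
exact: (probe_computable_bind (q2 := fun=> t * q)
  (g := fun y G => traject (f G) y t) (f_comp x)).
Qed.

Lemma probe_computable_factor (q : nat) A B
    (f : labeled_graph n -> A) (h : labeled_graph n -> B) :
  probe_computable D q f ->
  (forall G G', max_degree G <= D -> max_degree G' <= D ->
    f G = f G' -> h G = h G') ->
  probe_computable D q h.
Proof.
move=> f_comp fh.
have /choice[k kP] : forall a, exists b, forall G,
    max_degree G <= D -> f G = a -> h G = b.
  move=> a.
  have [[G [GD <-]]|noG] := pselect (exists G, max_degree G <= D /\ f G = a).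
    by exists (h G) => G' GD' /fh ->.
  by exists (h (edgeless_graph n)) => G GD fG; case: noG; exists G.
have [t tP] := probe_computable_comp k f_comp; exists t => G GD.
by have [tE tq] := tP G GD; rewrite tE (kP (f G) G).
Qed.

Lemma probe_computable_nbrs (v : 'I_n) : probe_computable D D (fun G => nbrs G v).
Proof.
have onth_comp i : probe_computable D 1 (fun G => onth (nbrs G v) i).
  exists (Probe v i.+1 (fun reply => Return (omap fst reply))) => G _ /=.
  by split=> //; case: onth.
have := probe_computable_map (iota 0 D) onth_comp; rewrite size_iota muln1.
move/probe_computable_factor; apply=> G G' GD GD' /eq_in_map eq_onth.
apply: eq_from_onth_le => i; rewrite leq_max => lti; apply: eq_onth.
rewrite mem_iota; have := deg_le_max G v; have := deg_le_max G' v.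
by rewrite /deg; case/orP: lti; lia.
Qed.

Lemma probe_computable_ball (r : nat) (v : 'I_n) :
  probe_computable D (D.+1 ^ r).-1 (fun G => ball G r v).
Proof.
elim: r => [|r IHr] /=; first exact: probe_computable_cst.
pose closed_nbhd s G := flatten [seq x :: nbrs G x | x <- s].
apply: (probe_computable_bind (q2 := fun s => size s * D) (g := closed_nbhd) IHr).
  move=> s; apply: (probe_computable_comp flatten).
  apply: probe_computable_map => x.
  exact: (probe_computable_comp (cons x) (probe_computable_nbrs x)).
move=> G GD; have := size_ball r v GD; have := expn_gt0 D.+1 r.
by rewrite expnS /=; nia.
Qed.

Lemma probe_computable_local (q r : nat) (v : 'I_n) A B
    (label : labeled_graph n -> 'I_n -> A) (h : labeled_graph n -> B) :
  (forall w, probe_computable D q (label^~ w)) ->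
  (forall G G', {in ball G r v, nbrs G =1 nbrs G'} ->
    {in ball G r v, label G =1 label G'} -> h G = h G') ->
  probe_computable D (D.+1 ^ r * (q + D).+1) h.
Proof.
move=> label_comp h_local.
pose view s G := (s, [seq (nbrs G w, label G w) | w <- s]).
have : probe_computable D (D.+1 ^ r * (q + D).+1) (fun G => view (ball G r v) G).
  apply: (probe_computable_bind (q2 := fun s => size s * (D + q)) (g := view)
    (probe_computable_ball r v)) => [s|G GD].
    apply: (probe_computable_comp (pair s)); apply: probe_computable_map => w.
    exact: probe_computable_pair (probe_computable_nbrs w) (label_comp w).
  by rewrite mulnS leq_add ?leq_pred // addnC leq_mul2r size_ball ?orbT.
move/probe_computable_factor; apply=> G G' _ _ [eq_ball].
rewrite -eq_ball => /eq_in_map eq_view.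
by apply: h_local => w /eq_view [].
Qed.

End ProbeComputable.

(** * Cole-Vishkin colour reduction *)

(* The least bit in which [x] and [y] differ, as the 2-adic valuation of their
   distance; it is [0] if [x = y]. *)
Definition differing_bit (x y : nat) : nat := logn 2 `|x - y|.

Definition bit (i x : nat) : bool := odd (x %/ 2 ^ i).

Lemma differing_bitC x y : differing_bit x y = differing_bit y x.
Proof. by rewrite /differing_bit distnC. Qed.

Lemma differing_bitP x y :
  x != y -> bit (differing_bit x y) x != bit (differing_bit x y) y.
Proof.
wlog lt_yx : x y / y < x => [wlog_lt|_].
  case: (ltngtP x y) => [lt_xy|lt_yx|->]; rewrite ?eqxx // => _.
  - by rewrite differing_bitC eq_sym wlog_lt // gtn_eqF.
  - by rewrite wlog_lt // gtn_eqF.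
rewrite /differing_bit distnEl; last exact: ltnW.
have dist_gt0 : 0 < x - y by rewrite subn_gt0.
have [u odd_u] := pfactor_coprime (isT : prime 2) dist_gt0.
set i := logn 2 _ => xyE.
have -> : x = u * 2 ^ i + y by rewrite -xyE subnK // ltnW.
rewrite /bit divnMDl ?expn_gt0 // oddD; rewrite coprime2n in odd_u.
by rewrite odd_u; case: odd.
Qed.

Lemma differing_bit_lt m x y :
  0 < m -> x < 2 ^ m -> y < 2 ^ m -> differing_bit x y < m.
Proof.
rewrite /differing_bit => m_gt0 ltx lty; case: (posnP `|x - y|) => [->|dist_gt0].
  by rewrite logn0.
rewrite -(ltn_exp2l _ _ (ltnSn 1)).
apply: leq_ltn_trans (dvdn_leq dist_gt0 (pfactor_dvdnn 2 _)) _; lia.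
Qed.

Definition cole_vishkin (x y : nat) : nat :=
  (differing_bit x y).*2 + bit (differing_bit x y) x.

Lemma cole_vishkin_lt m x y :
  0 < m -> x < 2 ^ m -> y < 2 ^ m -> cole_vishkin x y < m.*2.
Proof.
rewrite /cole_vishkin => m_gt0 ltx lty.
by have := differing_bit_lt m_gt0 ltx lty; case: bit; lia.
Qed.

Lemma cole_vishkin_neq x y z : x != y -> cole_vishkin x y != cole_vishkin y z.
Proof.
rewrite /cole_vishkin => /differing_bitP; apply: contraNneq => eq_cv.
have eq_bit : differing_bit x y = differing_bit y z.
  by move: eq_cv; case: bit; case: bit; lia.
by move: eq_cv; rewrite -eq_bit => /addnI; case: bit; case: bit.
Qed.

Fixpoint tower (j : nat) : nat := if j is i.+1 then 2 ^ tower i else 1.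

Lemma tower_gt0 j : 0 < tower j.
Proof. by case: j => //= j; rewrite expn_gt0. Qed.

Section IteratedColeVishkin.
Variables (T : Type) (ident : T -> nat).
Implicit Types (f g : T -> T) (v : T).

Fixpoint cv_color f (t : nat) v : nat :=
  if t is u.+1 then cole_vishkin (cv_color f u v) (cv_color f u (f v))
  else ident v.

Lemma cv_color_neq f t v :
  ident v != ident (f v) -> cv_color f t v != cv_color f t (f v).
Proof. by move=> neq; elim: t => //= t; apply: cole_vishkin_neq. Qed.

Lemma cv_color_lt f t j v :
  (forall w, ident w < 4 * tower (j + t) + 4) -> cv_color f t v < 4 * tower j + 4.
Proof.
elim: t j v => [|t IHt] j v /=; first by rewrite addn0; apply.
rewrite -(addSnnS j) => ident_lt; have tower_ge1 := tower_gt0 j.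
have lt_exp w : cv_color f t w < 2 ^ (tower j + 3).
  apply: leq_trans (IHt j.+1 w ident_lt) _; rewrite /= expnD.
  by have := expn_gt0 2 (tower j); lia.
by have := cole_vishkin_lt _ (lt_exp v) (lt_exp (f v)); lia.
Qed.

Lemma cv_color_traject f g t v :
  traject f v t.+1 = traject g v t.+1 -> cv_color f t v = cv_color g t v.
Proof.
elim: t v => // t IHt v eqt.
have eq1 : traject f v t.+1 = traject g v t.+1.
  by move: eqt; rewrite !(trajectSr _ _ t.+1) => /rcons_inj/(congr1 fst).
have [eqv eq2] : f v = g v /\ traject f (f v) t.+1 = traject g (g v) t.+1.
  by case: eqt => eqv eqt; split; rewrite //= eqt eqv.
by rewrite /= (IHt v) // -eqv IHt // eq2 eqv.
Qed.

End IteratedColeVishkin.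

(** * Linial's colour reduction *)

Lemma exists_finField_card N :
  0 < N -> exists F : finFieldType, N < #|F| <= 2 * N.
Proof.
move=> N_gt0.
have [F _ cardF] := pPrimePowerField (isT : prime 2) (ltn0Sn (trunc_log 2 N)).
have /andP[leN ltN] := trunc_log_bounds (ltnSn 1) N_gt0.
by exists F; rewrite cardF ltN expnS leq_mul2l.
Qed.

Lemma exists_nonroot (F : finFieldType) (p : {poly F}) :
  p != 0%R -> size p <= #|F| -> exists a, ~~ root p a.
Proof.
move=> p_neq0 size_p; apply/existsP; rewrite -negb_forall; apply/negP.
move=> /forallP all_root; suff : #|F| < size p by rewrite ltnNge size_p.
by rewrite cardE max_poly_roots ?enum_uniq //; apply/allP => a _; apply: all_root.
Qed.

Lemma size_prod_seq_le (R : idomainType) (d : nat) (ps : seq {poly R}) :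
  (forall p, p \in ps -> size p <= d.+1) ->
  size (\prod_(p <- ps) p)%R <= (size ps * d).+1.
Proof.
elim: ps => [|p ps IHps] size_le; first by rewrite big_nil size_poly1.
rewrite big_cons; apply: leq_trans (size_polyMleq _ _) _ => /=.
rewrite mulSn -subn1 leq_subLR add1n -addnS -addSn leq_add ?size_le ?mem_head //.
by apply: IHps => q q_ps; apply: size_le; rewrite inE q_ps orbT.
Qed.

Lemma exists_separating_point (F : finFieldType) (d : nat) (p : {poly F})
    (qs : seq {poly F}) :
  {in p :: qs, forall q : {poly F}, size q <= d.+1} -> size qs * d < #|F| ->
  exists a, {in qs, forall q : {poly F}, q != p -> (q.[a] != p.[a])%R}.
Proof.
move=> size_le lt_F; pose diffs := [seq (q - p)%R | q <- qs & q != p].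
have [||a] := @exists_nonroot F (\prod_(r <- diffs) r)%R.
- rewrite GRing.prodf_seq_eq0; apply/hasPn=> _ /mapP[q + ->].
  by rewrite mem_filter GRing.subr_eq0 => /andP[].
- apply: leq_trans lt_F; apply: leq_trans (size_prod_seq_le (d := d) _) _.
    move=> _ /mapP[q + ->]; rewrite mem_filter => /andP[_ q_qs].
    apply: leq_trans (size_polyD _ _) _; rewrite size_polyN geq_max.
    by rewrite !size_le ?mem_head // inE q_qs orbT.
  by rewrite ltnS leq_mul2r size_map size_filter count_size orbT.
rewrite root_bigmul => /allP nonroot; exists a => q q_qs neq.
have := nonroot (q - p)%R (map_f _ _); rewrite mem_filter neq q_qs.
by move/(_ isT); rewrite rootE !hornerE GRing.subr_eq0.
Qed.

Lemma exists_poly_encoding (F : finFieldType) (T : finType) (d : nat) :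
  #|T| <= #|F| ^ d ->
  exists2 P : T -> {poly F}, injective P & forall x, size (P x) <= d.
Proof.
rewrite -[d]mul1n -card_mx mul1n => card_le.
exists (fun x => rVpoly (enum_val (widen_ord card_le (enum_rank x)))).
  move=> x y /(can_inj rVpolyK)/enum_val_inj/(congr1 val) /= eq_rank.
  exact: enum_rank_inj (val_inj eq_rank).
by move=> x; apply: size_poly.
Qed.

(* A colour is a polynomial over [F], and the new colour of a vertex is a point
   of its graph lying on none of the graphs of its neighbours' polynomials. *)
Lemma linial_reduction (F : finFieldType) (T : finType) (d e : nat) :
  #|T| <= #|F| ^ d.+1 -> e * d < #|F| ->
  exists recolor : T -> seq T -> F * F, forall x y s t,
    size s <= e -> y \in s -> y != x -> recolor x s != recolor y t.
Proof.
move=> /exists_poly_encoding[P P_inj size_P] lt_F.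
have /choice[pt ptP] : forall xs : T * seq T, exists a, size xs.2 <= e ->
    {in xs.2, forall y, y != xs.1 -> ((P y).[a] != (P xs.1).[a])%R}.
  move=> [x s] /=; have [le_e|_] := leqP (size s) e; last by exists 0%R.
  have [||a aP] := @exists_separating_point F d (P x) [seq P y | y <- s].
  - by move=> q; rewrite -map_cons => /mapP[y _ ->].
  - by rewrite size_map (leq_ltn_trans _ lt_F) // leq_mul2r le_e orbT.
  by exists a => _ y ys neq; apply: aP; rewrite ?map_f ?(inj_eq P_inj).
exists (fun x s => (pt (x, s), (P x).[pt (x, s)]%R)) => x y s t le_e ys neq.
apply/negP=> /eqP[<- eqP]; have := ptP (x, s) le_e y ys neq.
by rewrite eqP eqxx.
Qed.

(** * Colouring the power graph *)

Section Coloring.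
Variables (n D r s : nat).
Hypothesis n_le_tower : n <= tower s.
Implicit Types (G : labeled_graph n) (v w : 'I_n).

Definition ball_nth G (i : nat) v : 'I_n := nth v (ball G r v) i.

(* The edges from each vertex to the i-th member of its ball form a functional
   graph, in which [s] rounds of Cole-Vishkin only look at a path of length [s];
   together these functional graphs cover the power graph. *)
Definition cv_vector G v : {ffun 'I_(D.+1 ^ r) -> 'I_8} :=
  [ffun i : 'I_(D.+1 ^ r) => inord (cv_color (@nat_of_ord n) (ball_nth G i) s v)].

Lemma cv_vector_neq G v w : max_degree G <= D ->
  w \in ball G r v -> v != w -> cv_vector G v != cv_vector G w.
Proof.
move=> GD wv neq.
have ltw : index w (ball G r v) < D.+1 ^ r.
  by apply: leq_trans (size_ball r v GD); rewrite index_mem.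
apply: contraNneq neq => /ffunP/(_ (Ordinal ltw))/(congr1 (@nat_of_ord 8)).
have lt8 u (f : 'I_n -> 'I_n) : cv_color (@nat_of_ord n) f s u < 8.
  apply: (@cv_color_lt _ _ _ _ 0) => x; rewrite add0n.
  by have := ltn_ord x; move: n_le_tower; rewrite /=; lia.
rewrite !ffunE !inordK //=; set f := ball_nth _ _.
have <- : f v = w by rewrite /f /ball_nth nth_index.
by apply: contra_eqT => neq; apply: cv_color_neq.
Qed.

Lemma probe_computable_ball_nth i v :
  probe_computable D (D.+1 ^ r) (fun G => ball_nth G i v).
Proof.
apply: (probe_computable_comp (fun b => nth v b i)).
exact: probe_computable_le (leq_pred _) (probe_computable_ball D r v).
Qed.

Lemma probe_computable_cv_vector v :
  probe_computable D (D.+1 ^ r * (s.+1 * D.+1 ^ r)) (fun G => cv_vector G v).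
Proof.
have := probe_computable_map (iota 0 (D.+1 ^ r)) (fun i =>
  probe_computable_traject s.+1 v (probe_computable_ball_nth i)).
rewrite size_iota => /probe_computable_factor; apply=> G G' _ _.
move=> /eq_in_map eq_traject.
apply/ffunP=> i; rewrite !ffunE; congr inord; apply: cv_color_traject.
by apply: eq_traject; rewrite mem_iota /=.
Qed.

Definition coloring_cost : nat :=
  D.+1 ^ r * (D.+1 ^ r * (s.+1 * D.+1 ^ r) + D).+1.

Lemma exists_local_coloring :
  exists Q (col : labeled_graph n -> 'I_n -> 'I_Q),
  [/\ Q <= (2 * ((D.+1 ^ r) ^ 2 + 8)) ^ 2,
      forall G v w, max_degree G <= D -> w \in ball G r v -> v != w ->
        col G v != col G w &
      forall v, probe_computable D coloring_cost (col^~ v)].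
Proof.
set d := D.+1 ^ r.
have d_gt0 : 0 < d by rewrite expn_gt0.
have [|F /andP[ltF leF]] := @exists_finField_card (d ^ 2 + 8).
  by rewrite addnS.
have [||recolor recolorP] :=
  @linial_reduction F {ffun 'I_d -> 'I_8} d.-1 d.
- rewrite card_ffun !card_ord prednK // leq_exp2r // ltnW //.
  by apply: leq_ltn_trans ltF; rewrite leq_addl.
- apply: leq_ltn_trans ltF; rewrite -mulnn; apply: leq_trans (leq_addr _ _).
  by rewrite leq_mul2l leq_pred orbT.
pose col G v :=
  enum_rank (recolor (cv_vector G v) [seq cv_vector G w | w <- ball G r v]).
exists #|{: F * F}|, col; split.
- by rewrite card_prod mulnn leq_exp2r.
- move=> G v w GD wv neq; rewrite (inj_eq enum_rank_inj).
  by apply: recolorP; rewrite ?size_map ?size_ball ?map_f // eq_sym cv_vector_neq.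
move=> v; apply: (probe_computable_local (r := r) (v := v)
  probe_computable_cv_vector) => G G' eqG eq_cv.
rewrite /col -(ball_local eqG) (eq_cv v) ?ball_center //.
by congr (enum_rank (recolor _ _)); apply/eq_in_map.
Qed.

End Coloring.

(** * Matchings as involutions *)

(* A matching, seen as the involution exchanging the ends of its edges. *)
Definition pairing (n : nat) (G : labeled_graph n) (m : 'I_n -> 'I_n) : Prop :=
  involutive m /\ forall x, m x != x -> m x \in nbrs G x.

Definition unmatched (n : nat) (m : 'I_n -> 'I_n) : {set 'I_n} :=
  [set x | m x == x].

Definition augment (n : nat) (m p : 'I_n -> 'I_n) (x : 'I_n) : 'I_n :=
  if p x == x then m x else p x.

Lemma pairing_id (n : nat) (G : labeled_graph n) : pairing G id.
Proof. by split=> // x; rewrite eqxx. Qed.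

Lemma pairing_augment (n : nat) (G : labeled_graph n) (m p : 'I_n -> 'I_n) :
  pairing G m -> pairing G p -> (forall x, p x != x -> p (m x) != m x) ->
  pairing G (augment m p).
Proof.
move=> [mK mG] [pK pG] pm; split=> x; rewrite /augment; last first.
  by case: ifP => [_ /mG|/negbT /pG].
have [px|px] := eqVneq (p x) x; last by rewrite pK eq_sym (negPf px).
by case: eqVneq => [//|/pm]; rewrite mK px eqxx.
Qed.

Lemma unmatched_augment (n : nat) (m p : 'I_n -> 'I_n) :
  unmatched (augment m p) = unmatched m :\: [set x | p x != x].
Proof.
apply/setP=> x; rewrite !inE /augment negbK.
by case: (eqVneq (p x) x) => // /negPf.
Qed.

Lemma pairing_ball (n : nat) (G : labeled_graph n) (m : 'I_n -> 'I_n) r v x :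
  pairing G m -> x \in ball G r v -> m x \in ball G r.+1 v.
Proof.
move=> [_ mG] xv; apply/ballSP; exists x => //.
by have [->|/mG] := eqVneq (m x) x; auto.
Qed.

(** * Local improvements *)

Section Improvement.
Variables (n : nat).
Implicit Types (G : labeled_graph n) (m p : 'I_n -> 'I_n) (region : seq 'I_n).

Definition improving G m region p : Prop :=
  [/\ pairing G p, forall x, p x != x -> x \in region,
      forall x, p x != x -> p (m x) != m x & exists2 x, p x != x & m x = x].

Definition improvement G m region : {ffun 'I_n -> 'I_n} :=
  odflt [ffun x => x]
    [pick p : {ffun 'I_n -> 'I_n} | `[< improving G m region p >]].

Lemma improving_local G G' m m' region p :
  {in region, nbrs G =1 nbrs G'} -> {in region, m =1 m'} ->
  improving G m region p -> improving G' m' region p.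
Proof.
move=> eqG eqm [[pK pG] p_sub pm [x px mx]]; split=> //.
- by split=> // y py; rewrite -eqG ?pG ?p_sub.
- by move=> y py; rewrite -eqm ?pm ?p_sub.
- by exists x; rewrite // -eqm ?p_sub.
Qed.

Lemma improvement_local G G' m m' region :
  {in region, nbrs G =1 nbrs G'} -> {in region, m =1 m'} ->
  improvement G m region = improvement G' m' region.
Proof.
move=> eqG eqm; congr odflt; apply: eq_pick => p.
by apply: asbool_equiv_eq; split; apply: improving_local => x /[dup] /eqG + /eqm.
Qed.

Lemma improvement_neq_improving G m region x :
  improvement G m region x != x -> improving G m region (improvement G m region).
Proof.
by rewrite /improvement; case: pickP => [p /asboolP|_] //=; rewrite ffunE eqxx.
Qed.

Lemma improvement_improving G m region p :
  improving G m region p -> improving G m region (improvement G m region).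
Proof.
rewrite /improvement; case: pickP => [q /asboolP //|no_improving] p_improving.
have /asboolP[] := no_improving (finfun p).
suff -> : (finfun p : 'I_n -> 'I_n) = p by [].
by apply/funext => x; rewrite ffunE.
Qed.

End Improvement.

(** * Sweeping over the colours *)

Lemma leq_card_bigcup (I T : finType) (P : pred I) (B : I -> {set T}) :
  #|\bigcup_(i | P i) B i| <= \sum_(i | P i) #|B i|.
Proof.
elim/big_rec2: _ => [|i k U _ le_U]; first by rewrite cards0.
by apply: leq_trans (leq_card_setU _ _) _; rewrite leq_add2l.
Qed.

Section Sweep.
Variables (n r Q : nat).
Implicit Types (G : labeled_graph n) (col : 'I_n -> 'I_Q) (m : 'I_n -> 'I_n).
Implicit Types (v w x y : 'I_n).

Definition center G col (c : nat) x : option 'I_n :=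
  ohead [seq v <- ball G r x | col v == c :> nat].

Definition patch G col m (c : nat) x : 'I_n :=
  if center G col c x is Some v then improvement G m (ball G r v) x else x.

Fixpoint matched G col (t : nat) : 'I_n -> 'I_n :=
  if t is u.+1 then
    augment (matched G col u) (patch G col (matched G col u) (u %% Q))
  else id.

Lemma centerP G col c x v :
  center G col c x = Some v -> v \in ball G r x /\ col v = c :> nat.
Proof.
rewrite /center => center_v.
have : v \in [seq w <- ball G r x | col w == c :> nat].
  by case: filter center_v => //= w s [->]; rewrite mem_head.
by rewrite mem_filter => /andP[/eqP].
Qed.

Lemma patch_local G G' col col' m m' c x :
  {in ball G (2 * r) x, nbrs G =1 nbrs G'} ->
  {in ball G (2 * r) x, col =1 col'} -> {in ball G (2 * r) x, m =1 m'} ->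
  patch G col m c x = patch G' col' m' c x.
Proof.
rewrite mul2n -addnn => eqG eqcol eqm.
have sub_ball v w :
    v \in ball G r x -> w \in ball G r v -> w \in ball G (r + r) x.
  exact: ball_trans.
have eq_ball : ball G r x = ball G' r x.
  apply: ball_local => w wx; apply: eqG.
  exact: sub_ball wx (ball_center _ _ _).
have eq_center : center G col c x = center G' col' c x.
  rewrite /center -eq_ball; congr ohead; apply: eq_in_filter => w wx.
  by rewrite eqcol //; apply: sub_ball wx (ball_center _ _ _).
rewrite /patch -eq_center; case center_v: (center G col c x) => [v|] //.
have [vx _] := centerP center_v.
rewrite -(ball_local (G := G)) => [|w wv]; last exact: eqG (sub_ball _ _ vx wv).
by rewrite (improvement_local (G' := G') (m' := m')) // => w /(sub_ball _ _ vx);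
  [apply: eqG|apply: eqm].
Qed.

Lemma matched_local G G' col col' t x :
  {in ball G (2 * r * t) x, nbrs G =1 nbrs G'} ->
  {in ball G (2 * r * t) x, col =1 col'} ->
  matched G col t x = matched G' col' t x.
Proof.
elim: t x => //= t IHt x; rewrite mulnS => eqG eqcol.
have eq_matched : {in ball G (2 * r) x, matched G col t =1 matched G' col' t}.
  by move=> y yx; apply: IHt => z zy; [apply: eqG|apply: eqcol];
     apply: ball_trans yx zy.
have sub : {subset ball G (2 * r) x <= ball G (2 * r + 2 * r * t) x}.
  by apply: ball_mono; apply: leq_addr.
rewrite /augment (eq_matched x (ball_center _ _ _)).
by rewrite (@patch_local G G' col col' _ _ (t %% Q) x (sub_in1 sub eqG)
  (sub_in1 sub eqcol) eq_matched).
Qed.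

Variables (G : labeled_graph n) (col : 'I_n -> 'I_Q).
Hypothesis col_proper :
  forall v w, w \in ball G (2 * r) v -> v != w -> col v != col w.

Lemma patch_center m v x :
  x \in ball G r v -> patch G col m (col v) x = improvement G m (ball G r v) x.
Proof.
move=> xv; rewrite /patch; case center_w: center => [w|]; last first.
  suff : v \in [seq w <- ball G r x | col w == col v :> nat].
    by move: center_w; rewrite /center; case: filter.
  by rewrite mem_filter eqxx ball_sym.
have [wx /val_inj col_w] := centerP center_w.
suff -> : v = w by [].
apply: contra_eq col_w => neq; rewrite eq_sym; apply: col_proper neq.
by rewrite mul2n -addnn; apply: ball_trans wx.
Qed.

Lemma patch_neqP m c x : patch G col m c x != x ->
  exists v, [/\ c = col v, x \in ball G r v &
    improving G m (ball G r v) (improvement G m (ball G r v))].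
Proof.
rewrite /patch; case center_v: center => [v|]; last by rewrite eqxx.
have [vx <-] := centerP center_v => /improvement_neq_improving improves.
by exists v; split=> //; apply: ball_sym.
Qed.

Lemma pairing_augment_patch m c :
  pairing G m -> pairing G (augment m (patch G col m c)).
Proof.
move=> mG; apply: pairing_augment => //; last first.
  move=> x px; have [v [cE xv [_ p_sub pm _]]] := patch_neqP px.
  by move: px; rewrite cE patch_center // => px; rewrite patch_center ?p_sub ?pm.
split=> x; last first.
  move=> px; have [v [cE xv [[_ pG] _ _ _]]] := patch_neqP px.
  by move: px; rewrite cE patch_center // => /pG.
have [px|px] := eqVneq (patch G col m c x) x; first by rewrite !px.
have [v [cE xv [[pK _] p_sub _ _]]] := patch_neqP px; move: px.
rewrite cE (patch_center _ xv) => px.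
by rewrite patch_center ?pK // p_sub // pK eq_sym.
Qed.

Lemma pairing_matched t : pairing G (matched G col t).
Proof. by elim: t => [|t]; [apply: pairing_id|apply: pairing_augment_patch]. Qed.

Lemma unmatched_matched_subset t u :
  t <= u -> unmatched (matched G col u) \subset unmatched (matched G col t).
Proof.
move=> /subnKC <-; elim: (u - t) => [|i IHi]; rewrite ?addn0 // addnS.
by apply: subset_trans IHi; rewrite /= unmatched_augment subsetDl.
Qed.

Definition newly_matched t u : {set 'I_n} :=
  unmatched (matched G col t) :\: unmatched (matched G col u).

Lemma newly_matched_sub t u u' t' :
  t <= u -> u' <= t' -> newly_matched u u' \subset newly_matched t t'.
Proof. by move=> tu ut; rewrite setDSS ?unmatched_matched_subset. Qed.

Lemma patch_neq_newly_matched t x :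
  patch G col (matched G col t) (t %% Q) x != x ->
  exists2 y, y \in newly_matched t t.+1 & x \in ball G (2 * r) y.
Proof.
move=> px; have [v [cE xv [_ p_sub _ [y py my]]]] := patch_neqP px; exists y.
  rewrite /newly_matched /= unmatched_augment !inE cE.
  by rewrite patch_center ?p_sub // py my eqxx.
rewrite mul2n -addnn; apply: (ball_trans (y := v)) => //.
by apply/ball_sym/p_sub.
Qed.

Lemma matched_stable t u x : t <= u ->
  (forall y, y \in newly_matched t u -> x \notin ball G (2 * r) y) ->
  matched G col u x = matched G col t x.
Proof.
move=> /subnKC <-; elim: (u - t) => [|c IHc]; rewrite ?addn0 // addnS => far.
rewrite /= /augment; case: eqVneq => [_|/patch_neq_newly_matched[y y_new]].
  apply: IHc => y y_new; apply: far; apply: subsetP y_new.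
  exact: newly_matched_sub.
apply: contraTeq => _; apply: far; apply: subsetP y_new.
exact: newly_matched_sub (leq_addr _ _) (leqnn _).
Qed.

(* If nothing is newly matched around [v] before its colour is served, then the
   improvement available at the start of the sweep is still available then. *)
Lemma sweep_newly_matched t v p : Q %| t ->
  improving G (matched G col t) (ball G r v) p ->
  exists2 y, y \in newly_matched t (t + Q) & v \in ball G (3 * r) y.
Proof.
move=> Qt p_improving; apply: contrapT => far.
have served : t + col v < t + Q by rewrite ltn_add2l.
have stable : {in ball G r v, matched G col t =1 matched G col (t + col v)}.
  move=> x xv; rewrite (matched_stable (t := t)) ?leq_addr // => y y_new.
  apply/negP=> xy; apply: far; exists y.
    by apply: subsetP y_new; apply: newly_matched_sub; rewrite // ltnW.
  have -> : 3 * r = 2 * r + r by lia.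
  exact: ball_trans xy (ball_sym xv).
have [_ p_sub _ [y py my]] :=
  improvement_improving (improving_local (fun x _ => erefl) stable p_improving).
apply: far; exists y.
  apply: subsetP (_ : y \in newly_matched (t + col v) (t + col v).+1).
    exact: newly_matched_sub (leq_addr _ _) served.
  rewrite /newly_matched /= unmatched_augment !inE my eqxx.
  have -> : (t + col v) %% Q = col v.
    by rewrite -modnDml (eqP Qt) add0n modn_small.
  by rewrite patch_center ?p_sub // py.
by apply: ball_mono (ball_sym (p_sub _ py)); rewrite leq_pmull.
Qed.

Lemma sweep_progress D t (A : {set 'I_n}) : max_degree G <= D -> Q %| t ->
  (forall v, v \in A -> exists p, improving G (matched G col t) (ball G r v) p) ->
  #|A| + D.+1 ^ (3 * r) * #|unmatched (matched G col (t + Q))| <=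
    D.+1 ^ (3 * r) * #|unmatched (matched G col t)|.
Proof.
move=> GD Qt A_improving.
rewrite -(cardsID (unmatched (matched G col (t + Q)))
  (unmatched (matched G col t))) -/(newly_matched t (t + Q)).
rewrite (setIidPr (unmatched_matched_subset (leq_addr Q t))).
rewrite mulnDr addnC leq_add2l.
have : A \subset
    \bigcup_(y in newly_matched t (t + Q)) [set v in ball G (3 * r) y].
  apply/subsetP=> v /A_improving[p /(sweep_newly_matched Qt)[y y_new vy]].
  by apply/bigcupP; exists y; rewrite // inE.
move=> /subset_leq_card/leq_trans; apply.
apply: leq_trans (leq_card_bigcup _ _) _; rewrite [leqRHS]mulnC -sum_nat_const.
apply: leq_sum => y _; rewrite cardsE.
exact: leq_trans (card_size _) (size_ball _ _ GD).
Qed.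

End Sweep.

(** * Alternating walks *)

Definition restrict (n : nat) (A : {set 'I_n}) (s : 'I_n -> 'I_n) (x : 'I_n) :
    'I_n :=
  if x \in A then s x else x.

Lemma improving_restrict (n : nat) (G : labeled_graph n) (m s : 'I_n -> 'I_n)
    (region : seq 'I_n) (A : {set 'I_n}) :
  pairing G s -> {in A, forall x, s x \in A} -> {in A, forall x, s x != x} ->
  {in A, forall x, m x \in A} -> {subset A <= region} ->
  (exists2 x, x \in A & m x = x) -> improving G m region (restrict A s).
Proof.
move=> [sK sG] sA s_neq mA A_sub [x xA mx].
have restrict_neq y : (restrict A s y != y) = (y \in A).
  by rewrite /restrict; have [/s_neq|] := boolP (y \in A); rewrite ?eqxx.
split.
- split=> y; last by rewrite restrict_neq /restrict => yA; rewrite yA sG ?s_neq.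
  by rewrite {2}/restrict; case: ifP => yA; rewrite /restrict ?sA ?sK ?yA.
- by move=> y; rewrite restrict_neq => /A_sub.
- by move=> y; rewrite !restrict_neq => /mA.
- by exists x; rewrite ?restrict_neq.
Qed.

(* From an m-free vertex, follow edges of s and m alternately.  The walk stops at
   a vertex free for s, or at one free for m, in which case it is augmenting. *)
Section AlternatingWalk.
Variables (n : nat) (G : labeled_graph n) (m s : 'I_n -> 'I_n).
Hypotheses (mG : pairing G m) (sG : pairing G s).
Implicit Types (i j k : nat) (v w x : 'I_n).

Definition walk i v : 'I_n := iter i (m \o s) v.

Definition s_end i v : bool := s (walk i v) == walk i v.
Definition m_end i v : bool := m (s (walk i v)) == s (walk i v).

Definition alive j v : bool := [forall i : 'I_j, ~~ s_end i v && ~~ m_end i v].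

Lemma aliveP j v :
  reflect (forall i, i < j -> ~~ s_end i v /\ ~~ m_end i v) (alive j v).
Proof.
apply: (iffP forallP) => [alive_j i ltij|alive_j i]; last exact/andP/alive_j.
exact/andP/(alive_j (Ordinal ltij)).
Qed.

Definition short_augmenting k : {set 'I_n} :=
  [set v in unmatched m |
    [exists j : 'I_k, [&& alive j v, ~~ s_end j v & m_end j v]]].

Definition short_blocked k : {set 'I_n} :=
  [set v in unmatched m | [exists j : 'I_k, alive j v && s_end j v]].

Definition long_walk k : {set 'I_n} := [set v in unmatched m | alive k v].

Lemma unmatched_sub_walks k :
  unmatched m \subset short_augmenting k :|: short_blocked k :|: long_walk k.
Proof.
apply/subsetP=> v; rewrite !inE => -> /=.
have [_|] := boolP (alive k v); first by rewrite orbT.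
rewrite negb_forall orbF => /existsP[i0 end_i0].
pose ends (i : 'I_k) := s_end i v || m_end i v.
have {}end_i0 : ends i0 by rewrite /ends -[_ || _]negbK negb_or.
have [i end_i min_i] := arg_minnP (val : 'I_k -> nat) end_i0.
have alive_i : alive i v.
  apply/forallP=> l; rewrite -negb_or; apply: contraTN (ltn_ord l).
  by rewrite -leqNgt => /(min_i (widen_ord (ltnW (ltn_ord i)) l)).
apply/orP; have [s_end_i|s_end_i] := boolP (s_end i v).
  by right; apply/existsP; exists i; rewrite alive_i.
left; apply/existsP; exists i; rewrite alive_i s_end_i /=.
by move: end_i; rewrite /ends (negPf s_end_i).
Qed.

Lemma walk_ball i v : walk i v \in ball G (2 * i) v.
Proof.
elim: i => [|i IHi]; rewrite ?mem_head // mulnSr addn2.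
exact: pairing_ball mG (pairing_ball sG IHi).
Qed.

Definition alternating_path j v : {set 'I_n} :=
  [set x | [exists i : 'I_j.+1, (x == walk i v) || (x == s (walk i v))]].

Lemma alternating_pathP j v x :
  reflect (exists2 i, i <= j & x = walk i v \/ x = s (walk i v))
          (x \in alternating_path j v).
Proof.
rewrite inE; apply: (iffP existsP) => [[i xi]|[i leij xi]].
  by exists i; [rewrite -ltnS|case/orP: xi => /eqP; auto].
by exists (Ordinal (leij : i < j.+1)); case: xi => /= <-; rewrite eqxx ?orbT.
Qed.

Lemma alternating_path_ball j v :
  {subset alternating_path j v <= ball G (2 * j.+1) v}.
Proof.
move=> _ /alternating_pathP[i leij [->|->]].
  by apply: ball_mono (walk_ball i v); lia.
by apply: ball_mono (pairing_ball sG (walk_ball i v)); lia.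
Qed.

Lemma alternating_path_s j v :
  {in alternating_path j v, forall x, s x \in alternating_path j v}.
Proof.
move=> x /alternating_pathP[i leij xi]; apply/alternating_pathP; exists i => //.
by case: xi => ->; rewrite ?sG.1; auto.
Qed.

Lemma alternating_path_s_neq j v : alive j v -> ~~ s_end j v ->
  {in alternating_path j v, forall x, s x != x}.
Proof.
move=> /aliveP alive_j s_end_j x /alternating_pathP[i leij xi].
have s_end_i : ~~ s_end i v.
  by move: leij; rewrite leq_eqVlt => /orP[/eqP->|/alive_j[]].
by case: xi => ->; rewrite ?sG.1 // eq_sym.
Qed.

Lemma alternating_path_m j v : m v = v -> m_end j v ->
  {in alternating_path j v, forall x, m x \in alternating_path j v}.
Proof.
move=> mv /eqP m_end_j _ /alternating_pathP[i leij [->|->]];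
  apply/alternating_pathP.
  case: i leij => [|i] leij; first by exists 0; auto.
  by exists i; [apply: ltnW|right; rewrite /= mG.1].
move: leij; rewrite leq_eqVlt => /orP[/eqP->|ltij]; last by exists i.+1; auto.
by exists j; auto.
Qed.

Lemma short_augmenting_improving k v : v \in short_augmenting k ->
  exists p, improving G m (ball G (2 * k) v) p.
Proof.
case/setIdP; rewrite inE => /eqP mv.
case/existsP=> j /and3P[alive_j s_end_j m_end_j].
exists (restrict (alternating_path j v) s); apply: improving_restrict => //.
- exact: alternating_path_s.
- exact: alternating_path_s_neq.
- exact: alternating_path_m.
- by move=> x /alternating_path_ball; apply: ball_mono; rewrite leq_mul2l ltn_ord.
- by exists v => //; apply/alternating_pathP; exists 0; auto.
Qed.

Lemma walk_inj i : injective (walk i).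
Proof.
by elim: i => [|i IHi] x y //= /(inv_inj mG.1)/(inv_inj sG.1)/IHi.
Qed.

Lemma walk_neq i j v w : m v = v -> alive j w -> i < j -> walk i v != walk j w.
Proof.
move=> mv /aliveP alive_j ltij; apply/negP.
have -> : j = i + (j - i).-1.+1 by lia.
rewrite /walk iterD => /eqP/walk_inj; rewrite iterS -/(walk _ w) /= => vE.
have [|_ /negP[]] := alive_j (j - i).-1; first by lia.
by rewrite /m_end -[s _]mG.1 -vE !mv.
Qed.

Lemma alive_walk_inj i j v w : v \in unmatched m -> w \in unmatched m ->
  alive i v -> alive j w -> walk i v = walk j w -> i = j /\ v = w.
Proof.
rewrite !inE => /eqP mv /eqP mw alive_i alive_j eq_walk.
have [ltij|ltji|eqij] := ltngtP i j.
- by have := walk_neq mv alive_j ltij; rewrite eq_walk eqxx.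
- by have := walk_neq mw alive_i ltji; rewrite eq_walk eqxx.
- by split=> //; move: eq_walk; rewrite eqij => /walk_inj.
Qed.

Lemma card_short_blocked k : #|short_blocked k| <= #|unmatched s|.
Proof.
pose stop v := [pick j : 'I_k | alive j v && s_end j v].
pose endpoint v := if stop v is Some j then walk j v else v.
have stopP v : v \in short_blocked k -> v \in unmatched m /\
    exists j : 'I_k, [/\ endpoint v = walk j v, alive j v & s_end j v].
  rewrite inE /endpoint /stop => /andP[mv /existsP[j end_j]]; split=> //.
  by case: pickP => [i /andP[]|/(_ j)]; [exists i|rewrite end_j].
have endpoint_inj : {in short_blocked k &, injective endpoint}.
  move=> v w /stopP[mv [i [-> alive_i _]]] /stopP[mw [j [-> alive_j _]]].
  by case/(alive_walk_inj mv mw alive_i alive_j).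
rewrite -(card_in_imset endpoint_inj); apply/subset_leq_card/subsetP.
by move=> _ /imsetP[v /stopP[_ [i [-> _ s_end_i]]] ->]; rewrite inE.
Qed.

Lemma card_long_walk k : k * #|long_walk k| <= #|~: unmatched s|.
Proof.
pose position (vi : 'I_n * 'I_k) := walk vi.2 vi.1.
have alive_le v j : alive k v -> j <= k -> alive j v.
  move=> /aliveP alive_k le_jk; apply/aliveP=> i ltij.
  exact: alive_k (leq_trans ltij le_jk).
have position_inj : {in setX (long_walk k) [set: 'I_k] &, injective position}.
  move=> [v i] [w j] /setXP[/setIdP[mv alive_v] _] /setXP[/setIdP[mw alive_w] _].
  have alive_i := alive_le v i alive_v (ltnW (ltn_ord i)).
  have alive_j := alive_le w j alive_w (ltnW (ltn_ord j)).
  by case/(alive_walk_inj mv mw alive_i alive_j) => /val_inj -> ->.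
have := card_in_imset position_inj; rewrite cardsX cardsT card_ord mulnC => <-.
apply/subset_leq_card/subsetP=> _ /imsetP[[v i] /setXP[/setIdP[_ alive_v] _] ->].
by have /aliveP/(_ _ (ltn_ord i))[s_end_i _] := alive_v; rewrite !inE.
Qed.

Lemma card_short_augmenting k :
  k * #|unmatched m| <=
    k * #|short_augmenting k| + (k * #|unmatched s| + #|~: unmatched s|).
Proof.
have : #|unmatched m| <=
    #|short_augmenting k| + #|short_blocked k| + #|long_walk k|.
  apply: leq_trans (subset_leq_card (unmatched_sub_walks k)) _.
  apply: leq_trans (leq_card_setU _ _) _.
  by rewrite leq_add2r leq_card_setU.
move=> le_walks; apply: leq_trans (leq_mul (leqnn k) le_walks) _.
rewrite !mulnDr addnA !leq_add ?card_long_walk //.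
by rewrite leq_mul2l card_short_blocked orbT.
Qed.

End AlternatingWalk.

(** * Convergence of the local search *)

Lemma iterated_decrease (f : nat -> nat) (c N K : nat) :
  (forall i, i < N -> c + K * f i.+1 <= K * f i) -> N * c + K * f N <= K * f 0.
Proof.
elim: N => [|N IHN] decr; first by rewrite mul0n.
have := decr N (ltnSn N); have := IHN (fun i ltiN => decr i (ltnW ltiN)).
by rewrite mulSn; lia.
Qed.

Definition search_steps (D k Q : nat) : nat := D.+1 ^ (3 * (2 * k)) * k * Q.

Section Convergence.
Variables (n D k Q : nat) (G : labeled_graph n).
Variables (col : 'I_n -> 'I_Q) (s : 'I_n -> 'I_n).
Hypotheses (k_gt0 : 0 < k) (GD : max_degree G <= D) (sG : pairing G s).
Hypothesis col_proper :
  forall v w, w \in ball G (2 * (2 * k)) v -> v != w -> col v != col w.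

Let sweep_loss : nat := D.+1 ^ (3 * (2 * k)).
Let swept i : 'I_n -> 'I_n := matched (2 * k) G col (i * Q).

Lemma sweep_decrease i :
  k * #|unmatched s| + 2 * #|~: unmatched s| < k * #|unmatched (swept i)| ->
  #|~: unmatched s|.+1 + sweep_loss * k * #|unmatched (swept i.+1)| <=
    sweep_loss * k * #|unmatched (swept i)|.
Proof.
move=> far; have mG := pairing_matched col_proper (i * Q).
have progress := sweep_progress col_proper GD (dvdn_mull i (dvdnn Q))
  (fun v => short_augmenting_improving mG sG (k := k) (v := v)).
rewrite -mulSnr -/(swept i) -/(swept i.+1) -/sweep_loss in progress.
have many_short : #|~: unmatched s| < k * #|short_augmenting (swept i) s k|.
  rewrite -(ltn_add2r (k * #|unmatched s| + #|~: unmatched s|)).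
  apply: leq_trans (card_short_augmenting mG sG k); apply: leq_trans far.
  by rewrite addnCA addnn -mul2n.
apply: leq_trans (_ : k * (#|short_augmenting (swept i) s k| +
  sweep_loss * #|unmatched (swept i.+1)|) <= _).
  by rewrite mulnDr mulnCA mulnA leq_add.
by rewrite [sweep_loss * k]mulnC -mulnA leq_mul2l progress orbT.
Qed.

Lemma sweeps_approximate :
  k * #|unmatched (matched (2 * k) G col (search_steps D k Q))| <=
    k * #|unmatched s| + 2 * #|~: unmatched s|.
Proof.
rewrite /search_steps -/sweep_loss -/(swept (sweep_loss * k)).
rewrite leqNgt; apply/negP=> far.
have decr i : i < sweep_loss * k -> #|~: unmatched s|.+1 +
    sweep_loss * k * #|unmatched (swept i.+1)| <=
    sweep_loss * k * #|unmatched (swept i)|.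
  move=> lti; apply: sweep_decrease; apply: leq_trans far _.
  rewrite leq_mul2l; apply/orP; right.
  apply/subset_leq_card/unmatched_matched_subset => //.
  by rewrite leq_mul2r ltnW ?orbT.
have swept0_le : #|unmatched (swept 0)| <= #|unmatched s| + #|~: unmatched s|.
  by rewrite cardsC max_card.
have sweeps_gt0 : 0 < sweep_loss * k by rewrite muln_gt0 k_gt0 expn_gt0.
have := leq_trans (iterated_decrease decr) (leq_mul (leqnn _) swept0_le).
rewrite -mulnDr leq_pmul2l // addSnnS addnC leq_add2r => /ltnW few_left.
move: far; rewrite ltnNge (leq_trans (leq_mul (leqnn k) few_left)) //.
exact: leq_addr.
Qed.

End Convergence.

(** * Matchings as edge sets *)

Lemma meet_eq_trivIset (T : finType) (P : {set {set T}}) :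
  (forall A B x, A \in P -> B \in P -> x \in A -> x \in B -> A = B) -> trivIset P.
Proof.
move=> meet_eq; apply/trivIsetP=> A B AP BP neq; rewrite -setI_eq0.
apply: contraNT neq => /set0Pn[x /setIP[xA xB]].
by apply/eqP; apply: meet_eq xA xB.
Qed.

Section EdgeSets.
Variables (n : nat) (G : labeled_graph n).
Implicit Types (M : {set {set 'I_n}}) (e : {set 'I_n}) (m : 'I_n -> 'I_n).

Lemma nbrs_neq u v : v \in nbrs G u -> v != u.
Proof. by apply: contraTneq => ->; apply: nbrs_irrefl. Qed.

Lemma edgesP e :
  reflect (exists u v, v \in nbrs G u /\ e = [set u; v]) (e \in edges G).
Proof.
rewrite inE; apply: (iffP existsP) => [[u /existsP[v /andP[vu /eqP eE]]]|].
  by exists u, v.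
by case=> u [v [vu ->]]; exists u; apply/existsP; exists v; rewrite vu eqxx.
Qed.

Lemma edge_endP e x : e \in edges G -> x \in e ->
  exists2 y, y \in nbrs G x & e = [set x; y].
Proof.
case/edgesP=> u [v [vu ->]]; rewrite !inE => /orP[]/eqP->; first by exists v.
by exists u; rewrite 1?nbrs_sym // setUC.
Qed.

Lemma card_edge e : e \in edges G -> #|e| = 2.
Proof. by case/edgesP=> u [v [/nbrs_neq neq ->]]; rewrite cards2 eq_sym neq. Qed.

Lemma edge_nonempty e : e \in edges G -> exists x, x \in e.
Proof. by move=> /card_edge e2; apply/card_gt0P; rewrite e2. Qed.

Lemma mem_edges u v : ([set u; v] \in edges G) = (v \in nbrs G u).
Proof.
apply/idP/idP => [uv|vu]; last by apply/edgesP; exists u, v.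
have [y yu uvE] := edge_endP uv (set21 u v).
by have := set22 u y; rewrite -uvE !inE (negPf (nbrs_neq yu)) => /eqP <-.
Qed.

Lemma matching_edges : max_degree G <= 1 -> matching G (edges G).
Proof.
move=> deg_le1; split=> //; apply: meet_eq_trivIset => e f x eG fG xe xf.
have [y yx ->] := edge_endP eG xe; have [z zx ->] := edge_endP fG xf.
have := leq_trans (deg_le_max G x) deg_le1; move: yx zx; rewrite /deg.
by case: (nbrs G x) => [|w [|]] //; rewrite !inE => /eqP-> /eqP->.
Qed.

Definition edge_set m : {set {set 'I_n}} :=
  [set [set x; m x] | x in ~: unmatched m].

Lemma mem_edge_set m e x : pairing G m -> e \in edges G -> x \in e ->
  (e \in edge_set m) = (e == [set x; m x]).
Proof.
move=> [mK _] eG xe; apply/imsetP/eqP => [[y _ eE]|eE].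
  by move: xe; rewrite eE !inE => /orP[]/eqP->; rewrite ?mK // setUC.
exists x => //; rewrite !inE; apply/eqP=> mx.
by have := card_edge eG; rewrite eE mx setUid cards1.
Qed.

Lemma matching_edge_set m : pairing G m -> matching G (edge_set m).
Proof.
move=> mG; have sub : edge_set m \subset edges G.
  apply/subsetP=> _ /imsetP[x xm ->]; rewrite mem_edges.
  by apply: mG.2; rewrite !inE in xm.
split=> //; apply: meet_eq_trivIset => e f x em fm xe xf.
have := em; rewrite (mem_edge_set mG (subsetP sub e em) xe) => /eqP->.
by have := fm; rewrite (mem_edge_set mG (subsetP sub f fm) xf) => /eqP->.
Qed.

Lemma card_edge_set m : pairing G m -> #|~: unmatched m| = 2 * #|edge_set m|.
Proof.
move=> mG; have [/subsetP sub triv] := matching_edge_set mG.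
rewrite mulnC; apply: card_uniform_partition => [e /sub/card_edge //|].
apply/and3P; split=> //; last first.
  by apply/negP=> /sub/card_edge; rewrite cards0.
apply/eqP/setP=> x; apply/bigcupP/idP => [[_ /imsetP[y ym ->]]|xm].
  by move: ym; rewrite !inE => ym /orP[]/eqP-> //; rewrite mG.1 eq_sym.
by exists [set x; m x]; rewrite ?set21 //; apply: imset_f.
Qed.

Definition pairing_of M (x : 'I_n) : 'I_n :=
  odflt x [pick y | (y != x) && ([set x; y] \in M)].

Lemma pairing_of_mem M x : pairing_of M x != x -> [set x; pairing_of M x] \in M.
Proof. by rewrite /pairing_of; case: pickP => [y /andP[]|] //=; rewrite eqxx. Qed.

Lemma matching_edgeE M e x :
  matching G M -> e \in M -> x \in e -> e = [set x; pairing_of M x].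
Proof.
move=> [/subsetP sub triv] eM xe; have [y yx eE] := edge_endP (sub e eM) xe.
rewrite /pairing_of; case: pickP => [z /andP[_ xzM]|/(_ y)] /=.
  by rewrite -(def_pblock triv eM xe) (def_pblock triv xzM) ?set21.
by rewrite (nbrs_neq yx) -eE eM.
Qed.

Lemma pairing_pairing_of M : matching G M -> pairing G (pairing_of M).
Proof.
move=> MG; split=> x; last first.
  by move/pairing_of_mem/(subsetP MG.1); rewrite mem_edges.
have [px|px] := eqVneq (pairing_of M x) x; first by rewrite !px.
have := set21 x (pairing_of M x).
rewrite {1}(matching_edgeE MG (pairing_of_mem px) (set22 _ _)) !inE.
by rewrite eq_sym (negPf px) => /eqP <-.
Qed.

Lemma pairing_ofK M : matching G M -> edge_set (pairing_of M) = M.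
Proof.
move=> MG; have pG := pairing_pairing_of MG; apply/setP=> e.
apply/idP/idP => [/imsetP[x + ->]|eM].
  by rewrite !inE; apply: pairing_of_mem.
have eG := subsetP MG.1 e eM; have [x xe] := edge_nonempty eG.
by rewrite (mem_edge_set pG eG xe) -(matching_edgeE MG eM xe) eqxx.
Qed.

Definition near_maximum (k : nat) M : Prop :=
  forall M', matching G M' -> k * #|M'| <= k * #|M| + 2 * #|M'|.

Lemma near_maximum_edges k : near_maximum k (edges G).
Proof.
move=> M [ME _]; apply: leq_trans (leq_addr _ _).
by rewrite leq_mul2l subset_leq_card ?orbT.
Qed.

Lemma near_maximum_edge_set k m : pairing G m ->
  (forall s, pairing G s ->
    k * #|unmatched m| <= k * #|unmatched s| + 2 * #|~: unmatched s|) ->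
  near_maximum k (edge_set m).
Proof.
move=> mG m_opt M MG; have sG := pairing_pairing_of MG; have := m_opt _ sG.
have : #|unmatched m| + #|~: unmatched m| =
    #|unmatched (pairing_of M)| + #|~: unmatched (pairing_of M)|.
  by rewrite !cardsC.
rewrite !card_edge_set // pairing_ofK // => /(congr1 (muln k)).
by rewrite !mulnDr; lia.
Qed.

End EdgeSets.

(** * Answering edge queries *)

Definition answers_edge_queries (n : nat) (G : labeled_graph n)
    (M : {set {set 'I_n}}) (q : nat) (ans : {set 'I_n} -> probing n bool) :
    Prop :=
  {in edges G, forall e, exec G (ans e) = (e \in M) /\ probes G (ans e) <= q}.

Lemma exists_edge_set_queries (n D q : nat)
    (m : labeled_graph n -> 'I_n -> 'I_n) :
  (forall x, probe_computable D q (m^~ x)) ->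
  exists ans, forall G, max_degree G <= D -> pairing G (m G) ->
    answers_edge_queries G (edge_set (m G)) q ans.
Proof.
move=> m_comp.
have /choice[ans ansP] : forall e : {set 'I_n}, exists t,
    forall G, max_degree G <= D ->
    exec G t = (if [pick x in e] is Some x then e == [set x; m G x] else false) /\
    probes G t <= q.
  move=> e; case: pickP => [x _|_]; last by exists (Return false).
  exact: (probe_computable_comp (fun y => e == [set x; y]) (m_comp x)).
exists ans => G GD mG e eG; have [-> probes_le] := ansP e G GD; split=> //.
case: pickP => [x xe|e0]; first by rewrite (mem_edge_set mG eG xe).
by have [x] := edge_nonempty eG; rewrite [x \in e]e0.
Qed.

Lemma probe_computable_matched (n D r Q q t : nat)
    (col : labeled_graph n -> 'I_n -> 'I_Q) (x : 'I_n) :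
  (forall v, probe_computable D q (col^~ v)) ->
  probe_computable D (D.+1 ^ (2 * r * t) * (q + D).+1)
    (fun G => matched r G (col G) t x).
Proof.
move=> col_comp; apply: (probe_computable_local (v := x) col_comp) => G G'.
exact: matched_local.
Qed.

(** * The number of probes *)

Lemma expn_leq_exp2 b e : b ^ e <= 2 ^ (b * e).
Proof.
case: e => [|e]; first by rewrite muln0.
by rewrite expnM leq_exp2r // ltnW // ltn_expl.
Qed.

Section ProbeCount.
Variables D k s Q : nat.
Hypotheses (D_gt1 : 1 < D) (k_gt0 : 0 < k) (s_gt0 : 0 < s).
Hypothesis Q_le : Q <= (2 * ((D.+1 ^ (2 * (2 * k))) ^ 2 + 8)) ^ 2.

Let ball_size : nat := D.+1 ^ (2 * (2 * k)).

Lemma ball_size_ge9 : 9 <= ball_size.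
Proof.
apply: leq_trans (_ : D.+1 ^ 2 <= _); first by rewrite -[9]/(3 ^ 2) leq_exp2r.
by rewrite leq_pexp2l //; lia.
Qed.

Lemma degree_lt_ball_size : D < ball_size.
Proof. by rewrite -[D.+1]expn1 leq_pexp2l //; lia. Qed.

Lemma k_le_ball_size : k <= ball_size.
Proof.
apply: leq_trans (ltnW (ltn_expl k (_ : 1 < D.+1))) _; first exact: ltnW.
by rewrite leq_pexp2l //; lia.
Qed.

Lemma coloring_cost_le :
  (coloring_cost D (2 * (2 * k)) s + D).+1 <= s * ball_size ^ 4.
Proof.
rewrite /coloring_cost -/ball_size.
have := degree_lt_ball_size; have := ball_size_ge9.
rewrite !expnS expn0 muln1; move: ball_size s_gt0 => b; nia.
Qed.

Lemma search_steps_le : search_steps D k Q <= ball_size ^ 9.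
Proof.
have ge9 := ball_size_ge9.
have le_sweep : D.+1 ^ (3 * (2 * k)) <= ball_size ^ 2.
  by rewrite -expnM leq_pexp2l //; lia.
have le_Q : Q <= (ball_size ^ 3) ^ 2.
  apply: leq_trans Q_le _; rewrite -/ball_size leq_exp2r //.
  by rewrite !expnS expn0 muln1; move: ball_size ge9 => b; nia.
have -> : ball_size ^ 9 = ball_size ^ 2 * ball_size * (ball_size ^ 3) ^ 2.
  by rewrite -expnM -expnSr -expnD.
by rewrite /search_steps !leq_mul // k_le_ball_size.
Qed.

Lemma search_cost_le :
  D.+1 ^ (2 * (2 * k) * search_steps D k Q)
    * (coloring_cost D (2 * (2 * k)) s + D).+1 <= s * 2 ^ (D ^ (88 * k)).
Proof.
rewrite expnM -/ball_size.
apply: leq_trans (leq_mul (leqnn _) coloring_cost_le) _.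
rewrite mulnCA leq_mul2l; apply/orP; right.
have ge9 := ball_size_ge9; have ball_size_gt0 : 0 < ball_size by lia.
apply: leq_trans (_ : ball_size ^ (ball_size ^ 9 + 4) <= _).
  by rewrite expnD leq_mul2r leq_pexp2l ?search_steps_le ?orbT.
apply: leq_trans (expn_leq_exp2 _ _) _; rewrite leq_pexp2l //.
apply: leq_trans (_ : ball_size ^ 11 <= _).
  have : 0 < ball_size ^ 9 by rewrite expn_gt0 ball_size_gt0.
  rewrite 2!expnS leq_mul2l.
  by move: (ball_size ^ 9) ge9 => p; nia.
apply: leq_trans (_ : (D ^ 2) ^ (2 * (2 * k) * 11) <= _); last first.
  by rewrite -expnM leq_pexp2l //; lia.
by rewrite /ball_size -expnM leq_exp2r; [rewrite expnS expn1; nia|lia].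
Qed.

End ProbeCount.

Lemma exists_near_maximum_queries (n D k s : nat) :
  1 < D -> 0 < k -> 0 < s -> n <= tower s ->
  exists ans, forall G : labeled_graph n, max_degree G <= D ->
    exists M, [/\ matching G M, near_maximum G k M &
      answers_edge_queries G M (s * 2 ^ (D ^ (88 * k))) ans].
Proof.
move=> D_gt1 k_gt0 s_gt0 le_tower.
have [Q [col [Q_le col_proper col_comp]]] :=
  exists_local_coloring D (2 * (2 * k)) le_tower.
pose m G := matched (2 * k) G (col G) (search_steps D k Q).
have m_comp x : probe_computable D (s * 2 ^ (D ^ (88 * k))) (m^~ x).
  apply: probe_computable_le (search_cost_le D_gt1 k_gt0 s_gt0 Q_le) _.
  exact: probe_computable_matched.
have [ans ansP] := exists_edge_set_queries m_comp.
exists ans => G GD; have col_properG v w := col_proper G v w GD.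
have mG : pairing G (m G) by apply: pairing_matched.
exists (edge_set (m G)); split; [exact: matching_edge_set| |exact: ansP].
by apply: near_maximum_edge_set => // s' s'G; apply: sweeps_approximate.
Qed.

Lemma max_degree_le_size (n : nat) (G : labeled_graph n) : max_degree G <= n.
Proof.
apply/bigmax_leqP=> v _; have := max_card (mem (nbrs G v)).
by rewrite card_ord (card_uniqP (nbrs_uniq G v)).
Qed.

Import Order.TTheory GRing.Theory Num.Theory.
Local Open Scope ring_scope.

Lemma le_tower_logstar (R : realType) (n : nat) : (n <= tower (logstar R n))%N.
Proof.
rewrite /logstar; case: ex_minnP => s + _.
suff log_tower (x : R) : iter s (@log2 R) x <= 1 -> x <= (tower s)%:R.
  by move/log_tower; rewrite ler_nat.
elim: s x => [|s IHs] x //; rewrite iterSr => /IHs le_log /=.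
have [x_le0|x_gt0] := leP x 0; first by apply: le_trans x_le0 (ler0n _ _).
have ln2_gt0 : 0 < ln (2 : R) by rewrite ln_gt0 // ltr1n.
move: le_log; rewrite /log2 ler_pdivrMr // mulr_natl -lnXn // ler_ln ?posrE //.
  by rewrite natrX.
by rewrite exprn_gt0.
Qed.

Lemma logstar_gt0 (R : realType) (n : nat) : (1 < n)%N -> (0 < logstar R n)%N.
Proof.
rewrite /logstar; case: ex_minnP => -[|s] // + _.
by rewrite /= lern1 leqNgt => /negP.
Qed.

Lemma probe_bound_ge0 (R : realType) (C eps : R) (n D : nat) :
  0 <= probe_bound C eps n D.
Proof. by rewrite mulr_ge0 ?powR_ge0 // exprz_ge0. Qed.

Lemma le_probe_bound (R : realType) (c eps : R) (n D d : nat) :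
  0 < eps -> (0 < D)%N -> (0 < logstar R n)%N -> d%:R <= c / eps ->
  (logstar R n * 2 ^ (D ^ d))%:R <= probe_bound c eps n D.
Proof.
move=> eps_gt0 D_gt0 log_gt0 d_le; rewrite natrM /probe_bound ler_pM //.
  have : 0 <= Num.ceil (1 / eps).
    by rewrite ceil_ge0 (lt_le_trans (ltrN10 _)) // divr_ge0 // ltW.
  case: (Num.ceil (1 / eps)) => // a _; rewrite -PoszD addn1 -exprnP.
  by rewrite exprS ler_peMr // exprn_ege1 // ler1n.
rewrite natrX -powR_mulrn // ler_powR ?ler1n // natrX -powR_mulrn //.
by rewrite ler_powR ?ler1n.
Qed.

Lemma exists_nat_near_inv (R : realType) (eps : R) : 0 < eps -> eps < 1 ->
  exists2 k : nat, 2 <= eps * k%:R & k%:R <= 3 / eps.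
Proof.
move=> eps_gt0 eps_lt1; exists (Num.truncn (2 / eps)).+1.
  by rewrite mulrC -ler_pdivrMr // ltW // truncnS_gt.
rewrite -natr1; apply: le_trans (_ : 2 / eps + 1 / eps <= _); last by lra.
rewrite lerD ?truncn_le //; first by rewrite divr_ge0 // ltW.
by rewrite ler_pdivlMr // mul1r ltW.
Qed.

Lemma near_maximum_approx (R : realType) (eps : R) (n k : nat)
    (G : labeled_graph n) (M : {set {set 'I_n}}) :
  (0 < k)%N -> 2 <= eps * k%:R -> matching G M -> near_maximum G k M ->
  approx_max_matching eps G M.
Proof.
move=> k_gt0 k_ge MG M_max; split=> // M' [M'G _].
rewrite -(ler_pM2l (_ : 0 < k%:R)) ?ltr0n //.
have := M_max M' M'G; rewrite -(ler_nat R) natrD !natrM => le_M.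
have card_ge0 : 0 <= #|M'|%:R :> R by [].
by nra.
Qed.

Lemma exists_stateless_CentLocal (R : realType)
    (sol : forall n, labeled_graph n -> {set {set 'I_n}} -> Prop)
    (q : nat -> nat -> R) :
  (forall n D, exists ans, forall G : labeled_graph n, max_degree G = D ->
    exists M b, [/\ sol n G M, answers_edge_queries G M b ans & b%:R <= q n D]) ->
  exists A, stateless A /\ CentLocal sol q A.
Proof.
move=> queries; pose ans n D := sval (cid (queries n D)).
exists (@EdgeAlgorithm (fun _ _ => unit) (fun _ _ => tt)
  (fun n D _ e => bind (ans n D e) (fun b => Return (b, tt)))); split.
  by move=> n D [] [].
move=> n G.
have [M [b [solM ansM b_le]]] := svalP (cid (queries n (max_degree G))) G erefl.
exists M; split=> // qs; elim: qs => [|e qs IHqs] //= sub_edges.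
have [|IHans IHprobes] := IHqs.
  by move=> f f_qs; apply: sub_edges; rewrite inE f_qs orbT.
have [ans_e probes_e] := ansM e (sub_edges e (mem_head e qs)).
rewrite exec_bind probes_bind addn0 ans_e IHans; split=> // p.
rewrite inE => /orP[/eqP->|/IHprobes //].
by apply: le_trans b_le; rewrite ler_nat.
Qed.

Theorem theorem19 (R : realType) :
  exists C : R, 0 < C /\
    forall eps : R, 0 < eps -> eps < 1 ->
      exists A : edge_algorithm,
        stateless A /\
        CentLocal (approx_max_matching eps) (probe_bound C eps) A.
Proof.
(* The exponent [88 * k] of the number of probes is at most [88 * (3 / eps)]. *)
exists 264; split=> // eps eps_gt0 eps_lt1.
have [k k_ge k_le] := exists_nat_near_inv eps_gt0 eps_lt1.
have k_gt0 : (0 < k)%N by case: k k_ge {k_le} => //; rewrite mulr0 lt_geF.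
apply: exists_stateless_CentLocal => n D.
have [D_le1|D_gt1] := leqP D 1.
  exists (fun=> Return true) => G GD; exists (edges G), 0%N; split.
  - apply: near_maximum_approx k_gt0 k_ge _ (near_maximum_edges k).
    by apply: matching_edges; rewrite GD.
  - by move=> e ->.
  - exact: probe_bound_ge0.
have [log0|log_gt0] := posnP (logstar R n).
  exists (fun=> Return true) => G GD; suff : (0 < logstar R n)%N by rewrite log0.
  by rewrite logstar_gt0 // (leq_trans D_gt1) // -GD max_degree_le_size.
have [ans ansP] :=
  exists_near_maximum_queries D_gt1 k_gt0 log_gt0 (le_tower_logstar R n).
exists ans => G GD; have [|M [MG M_max M_ans]] := ansP G; first by rewrite GD.
exists M, (logstar R n * 2 ^ (D ^ (88 * k)))%N; split=> //.
- exact: near_maximum_approx M_max.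
- by apply: le_probe_bound; rewrite ?(ltnW D_gt1) // natrM; lra.
Qed.
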